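(* Let $(\mathcal{M},d)$ be a Cartan-Hadamard manifold, let $S\subset\mathcal{M}$ be g-convex, and let $f:S\to\mathbb{R}$ and $h:\mathbb{R}\to\mathbb{R}$. 1. If $f$ is geodesically concave and $h$ is non-increasing and convex, then $h\circ f$ is geodesically convex on $S$. 2. If $f$ is geodesically concave and $h$ is non-decreasing and concave, then $h\circ f$ is geodesically concave on $S$. 3. If $f$ is geodesically convex and $h$ is non-increasing and concave, then $h\circ f$ is geodesically concave on $S$.
   Context: A Cartan-Hadamard manifold is a Riemannian manifold of non-positive sectional curvature in which every pair of points is connected by a unique geodesic, which is distance-minimizing; $d$ is the Riemannian distance. A set $S\subseteq\mathcal{M}$ is geodesically convex (g-convex) if for any $x,y\in S$ there is a geodesic $\gamma:[0,1]\to\mathcal{M}$ with $\gamma(0)=x$, $\gamma(1)=y$ and $\gamma([0,1])\subseteq S$. A function $f:S\to\mathbb{R}$ is geodesically convex if $S$ is g-convex and $f\circ\gamma:[0,1]\to\mathbb{R}$ is convex in the usual sense for each geodesic segment $\gamma:[0,1]\to\mathcal{M}$ with image in $S$ and $\gamma(0)\ne\gamma(1)$; $f$ is geodesically concave if $-f$ is geodesically convex. Convexity, concavity and monotonicity of $h:\mathbb{R}\to\mathbb{R}$ are in the usual sense. All functions considered are assumed continuous. *)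

(* Defs.v *)
From HB Require Import structures.
From mathcomp Require Import all_boot all_order all_algebra.
From mathcomp Require Import all_classical all_reals all_analysis.

Set Implicit Arguments.
Unset Strict Implicit.
Unset Printing Implicit Defensive.

Import Order.TTheory GRing.Theory Num.Theory.
Import numFieldNormedType.Exports.

Local Open Scope ring_scope.
Local Open Scope classical_set_scope.

Definition partial (R : realType) n (W : normedModType R)
    (a : 'I_n) (F : 'rV[R]_n -> W) : 'rV[R]_n -> W :=
  fun p => 'D_(delta_mx 0 a) F p.

(* Meaningful for [U] open: then neither continuity at a point of [U] nor the
   iterated partial derivatives on [U] depend on the values outside [U]. *)
Fixpoint Ck_on (R : realType) n (W : normedModType R) (k : nat)
    (U : set 'rV[R]_n) (F : 'rV[R]_n -> W) : Prop :=
  (forall p, U p -> {for p, continuous F}) /\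
  if k is k'.+1 then
    forall a : 'I_n,
      (forall p, U p -> derivable F p (delta_mx 0 a)) /\
      Ck_on k' U (partial a F)
  else True.

Definition smooth_on (R : realType) n (W : normedModType R)
    (U : set 'rV[R]_n) (F : 'rV[R]_n -> W) : Prop :=
  forall k, Ck_on k U F.

(* An atlas indexed by [chart]: the chart [i] is the homeomorphism
   [chart_coord i] from the open set [chart_dom i] onto an open subset of R^n,
   with inverse [chart_inv i]; the two functions are arbitrary outside these
   sets.  [chart_at] selects a chart around each point, so that the domains
   cover [carrier]. *)
Record smooth_manifold (R : realType) (n : nat) := SmoothManifold {
  carrier :> topologicalType ;
  manifold_hausdorff : hausdorff_space carrier ;
  manifold_second_countable : @second_countable carrier ;
  chart : Type ;
  chart_dom : chart -> set carrier ;
  chart_coord : chart -> carrier -> 'rV[R]_n ;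
  chart_inv : chart -> 'rV[R]_n -> carrier ;
  chart_at : carrier -> chart ;
  chart_dom_at : forall x, chart_dom (chart_at x) x ;
  open_chart_dom : forall i, open (chart_dom i) ;
  open_chart_img : forall i, open (chart_coord i @` chart_dom i) ;
  chart_coordK : forall i x, chart_dom i x ->
    chart_inv i (chart_coord i x) = x ;
  continuous_chart_coord : forall i x, chart_dom i x ->
    {for x, continuous (chart_coord i)} ;
  continuous_chart_inv : forall i p, (chart_coord i @` chart_dom i) p ->
    {for p, continuous (chart_inv i)} ;
  smooth_transition : forall i j,
    smooth_on (chart_coord i @` (chart_dom i `&` chart_dom j))
      (chart_coord j \o chart_inv i)
}.

Definition inner (R : realType) n (g : 'M[R]_n) (u v : 'rV[R]_n) : R :=
  (u *m g *m v^T) 0 0.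

(* The metric is given by its component matrices in the charts.  Tangent
   vectors are row vectors and [v *m 'J F p] is the differential of [F] at [p]
   applied to [v], whence the side of the transpose in
   [riemannian_metric_transition]. *)
Record riemannian_manifold (R : realType) (n : nat) := RiemannianManifold {
  manifold :> smooth_manifold R n ;
  metric : chart manifold -> 'rV[R]_n -> 'M[R]_n ;
  smooth_metric : forall i,
    smooth_on (chart_coord i @` chart_dom i) (metric i) ;
  riemannian_metric_sym : forall i p, (chart_coord i @` chart_dom i) p ->
    (metric i p)^T = metric i p ;
  riemannian_metric_pos : forall i p (v : 'rV[R]_n),
    (chart_coord i @` chart_dom i) p -> v != 0 ->
    0 < inner (metric i p) v v ;
  riemannian_metric_transition : forall i j p,
    (chart_coord i @` (chart_dom i `&` chart_dom j)) p ->
    let tau := chart_coord j \o chart_inv i in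
    metric i p = 'J tau p *m metric j (tau p) *m ('J tau p)^T
}.

(* The symbol Gamma^c_{ab} of the Levi-Civita connection of [g]. *)
Definition christoffel (R : realType) n (g : 'rV[R]_n -> 'M[R]_n)
    (c a b : 'I_n) (p : 'rV[R]_n) : R :=
  2^-1 * \sum_(d < n) invmx (g p) c d *
    (partial a (fun q => g q d b) p + partial b (fun q => g q d a) p
     - partial d (fun q => g q a b) p).

(* The l-th component of R(e_a, e_b) e_c, with the sign convention
   R(X, Y) Z = D_X D_Y Z - D_Y D_X Z - D_[X, Y] Z. *)
Definition riemann (R : realType) n (g : 'rV[R]_n -> 'M[R]_n)
    (l a b c : 'I_n) (p : 'rV[R]_n) : R :=
  partial a (christoffel g l b c) p - partial b (christoffel g l a c) p
  + \sum_(m < n) (christoffel g m b c p * christoffel g l a m p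
                  - christoffel g m a c p * christoffel g l b m p).

Definition curvature_endo (R : realType) n (g : 'rV[R]_n -> 'M[R]_n)
    (p u v w : 'rV[R]_n) : 'rV[R]_n :=
  \row_l \sum_(a < n) \sum_(b < n) \sum_(c < n)
    riemann g l a b c p * u 0 a * v 0 b * w 0 c.

Definition sectional_curvature (R : realType) n (g : 'rV[R]_n -> 'M[R]_n)
    (p u v : 'rV[R]_n) : R :=
  inner (g p) (curvature_endo g p u v v) u /
  (inner (g p) u u * inner (g p) v v - inner (g p) u v ^+ 2).

Definition nonpositively_curved (R : realType) n
    (M : riemannian_manifold R n) : Prop :=
  forall (i : chart M) (p u v : 'rV[R]_n),
    (chart_coord i @` chart_dom i) p -> row_free (col_mx u v) ->
    sectional_curvature (metric i) p u v <= 0.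

(* A geodesic on an open interval: a continuous curve that in every chart it
   meets is twice differentiable and solves the geodesic equation. *)
Definition geodesic_on (R : realType) n (M : riemannian_manifold R n)
    (a b : R) (gamma : R -> M) : Prop :=
  forall t, t \in `]a, b[ ->
    {for t, continuous gamma} /\
    forall i : chart M, chart_dom i (gamma t) ->
      let x := chart_coord i \o gamma in
      let x' := x^`() in
      let x'' := x'^`() in
      [/\ derivable x t 1, derivable x' t 1
        & forall c : 'I_n,
            x'' t 0 c + \sum_(k < n) \sum_(l < n)
              christoffel (metric i) c k l (x t) * x' t 0 k * x' t 0 l
            = 0].

(* A geodesic segment [0, 1] -> M is the restriction to [0, 1] of a geodesic
   on a larger open interval; only the values of [gamma] on [0, 1] are used
   below. *)
Definition geodesic_segment (R : realType) n (M : riemannian_manifold R n)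
    (gamma : R -> M) : Prop :=
  exists a b : R, [/\ a < 0, 1 < b & geodesic_on a b gamma].

(* The value does not depend on the chart around [c t], by
   [riemannian_metric_transition]. *)
Definition speed (R : realType) n (M : riemannian_manifold R n)
    (c : R -> M) (t : R) : R :=
  let i := chart_at (c t) in
  let v := (chart_coord i \o c)^`() t in
  Num.sqrt (inner (metric i (chart_coord i (c t))) v v).

Definition curve_length (R : realType) n (M : riemannian_manifold R n)
    (c : R -> M) : \bar R :=
  (\int[lebesgue_measure]_(t in `[0%R, 1%R]) (speed c t)%:E)%E.

Definition C1_on (R : realType) n (M : riemannian_manifold R n)
    (a b : R) (c : R -> M) : Prop :=
  forall t, t \in `]a, b[ ->
    {for t, continuous c} /\
    forall i : chart M, chart_dom i (c t) ->
      derivable (chart_coord i \o c) t 1 /\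
      {for t, continuous (chart_coord i \o c)^`()}.

(* On each closed piece of a subdivision of [0, 1], the curve extends to a C^1
   curve on a larger open interval. *)
Definition piecewise_C1 (R : realType) n (M : riemannian_manifold R n)
    (c : R -> M) : Prop :=
  exists (m : nat) (s : nat -> R),
    [/\ s 0%N = 0, s m = 1
      & forall k, (k < m)%N -> s k < s k.+1 /\
          exists (a b : R) (c' : R -> M),
            [/\ a < s k, s k.+1 < b, C1_on a b c'
              & {in `[s k, s k.+1], c =1 c'}]].

Definition riemannian_dist (R : realType) n (M : riemannian_manifold R n)
    (x y : M) : \bar R :=
  ereal_inf [set curve_length c | c in
    [set c : R -> M | [/\ piecewise_C1 c, c 0 = x & c 1 = y]]].

Definition geodesic_between (R : realType) n (M : riemannian_manifold R n)
    (x y : M) (gamma : R -> M) : Prop :=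
  [/\ geodesic_segment gamma, gamma 0 = x & gamma 1 = y].

Definition cartan_hadamard (R : realType) n
    (M : riemannian_manifold R n) : Prop :=
  nonpositively_curved M /\
  forall x y : M, exists gamma : R -> M,
    [/\ geodesic_between x y gamma,
        forall sigma, geodesic_between x y sigma ->
          {in `[0, 1], sigma =1 gamma}
      & curve_length gamma = riemannian_dist x y].

Definition g_convex_set (R : realType) n (M : riemannian_manifold R n)
    (S : set M) : Prop :=
  forall x y, S x -> S y ->
    exists gamma : R -> M,
      geodesic_between x y gamma /\ {in `[0, 1], forall t, S (gamma t)}.

(* A function S -> R is represented by a function on [M], of which only the
   values on [S] matter. *)
Definition g_convex (R : realType) n (M : riemannian_manifold R n)
    (S : set M) (f : M -> R) : Prop :=
  g_convex_set S /\
  forall gamma : R -> M, geodesic_segment gamma ->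
    {in `[0, 1], forall t, S (gamma t)} -> gamma 0 <> gamma 1 ->
    convex_function (`[0, 1]%classic : set R) (f \o gamma).

Definition g_concave (R : realType) n (M : riemannian_manifold R n)
    (S : set M) (f : M -> R) : Prop :=
  g_convex S (fun x => - f x).

Definition concave_function (R : realType) (D : set R) (h : R -> R) : Prop :=
  convex_function D (fun x => - h x).

(* Main.v *)
Require Import Defs.
From mathcomp Require Import all_boot all_order all_algebra.
From mathcomp Require Import all_classical all_reals all_analysis.

Import Order.TTheory GRing.Theory Num.Theory.
Import numFieldNormedType.Exports.

Local Open Scope classical_set_scope.
Local Open Scope ring_scope.

(** All three claims are instances of one rule, [g_convex_comp_nondecreasing]: a nondecreasing
    convex [k] preserves g-convexity under composition. The pairs (outer, inner) are [h (- x)] with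
    [- f], [- h (- x)] with [- f], and [- h] with [f]. Restricting to a geodesic reduces the rule to
    the classical one for convex functions. *)

Lemma convex_comp_nondecreasing {R : realType} {E : lmodType R}
    {D : set (convex_lmodType E)} {u : E -> R} {k : R -> R} :
  convex_function D u -> convex_function setT k -> nondecreasing_fun k ->
  convex_function D (k \o u).
Proof.
move=> cu ck ndk t x y xD yD; apply: le_trans (ck t _ _ _ _); rewrite ?inE//.
exact/ndk/cu.
Qed.

(** Negation is affine, so it commutes with convex combinations. *)
Lemma convex_precompN {R : realType} {k : R -> R} :
  convex_function setT k -> convex_function setT (fun x => k (- x)).
Proof. by move=> ck t x y _ _; rewrite convN; apply: ck; rewrite inE. Qed.

Lemma g_convex_comp_nondecreasing {R : realType} {n : nat}
    {M : riemannian_manifold R n} {S : set M} {f : M -> R} {k : R -> R} :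
  g_convex S f -> convex_function setT k -> nondecreasing_fun k ->
  g_convex S (k \o f).
Proof.
move=> [cS cf] ck ndk; split=> // gamma geo gS g01.
exact: convex_comp_nondecreasing (cf gamma geo gS g01) ck ndk.
Qed.

Theorem corollary6 (R : realType) (n : nat) (M : riemannian_manifold R n)
    (hM : cartan_hadamard M) (S : set M) (hS : g_convex_set S)
    (f : M -> R) (h : R -> R)
    (cf : {within S, continuous f}) (ch : continuous h) :
  [/\ g_concave S f -> nonincreasing_fun h ->
        convex_function (setT : set R) h -> g_convex S (h \o f),
      g_concave S f -> nondecreasing_fun h ->
        concave_function (setT : set R) h -> g_concave S (h \o f)
    & g_convex S f -> nonincreasing_fun h ->
        concave_function (setT : set R) h -> g_concave S (h \o f)].
Proof.
split=> [cvf nih cvh|cvf ndh cch|cvf nih cch].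
(* Writing [f] as [- (- f)] exposes the g-convex function [- f]; the reflection turns [h] into a
   nondecreasing function. *)
- have -> : h \o f = (fun x => h (- x)) \o (fun x => - f x).
    by apply/funext => x /=; rewrite opprK.
  apply: g_convex_comp_nondecreasing cvf (convex_precompN cvh) _.
  by move=> x y xy; apply: nih; rewrite lerN2.
- rewrite /g_concave.
  have -> : (fun x => - (h \o f) x) =
      (fun x => - h (- x)) \o (fun x => - f x).
    by apply/funext => x /=; rewrite opprK.
  apply: g_convex_comp_nondecreasing cvf (convex_precompN cch) _.
  by move=> x y xy; rewrite lerN2; apply: ndh; rewrite lerN2.
(* No reflection here: [- h] is itself convex and nondecreasing, and the goal unfolds to its
   composition with [f]. *)
- apply: (g_convex_comp_nondecreasing cvf cch).
  by move=> x y xy; rewrite lerN2; apply: nih.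
Qed.
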